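(* (Anti-concentration inside the ball.) Consider the true Boolean product distribution $\mathcal{D}(p^\star)$ on $\Pi_d=\{0,1\}^d$ and let $\mathcal{D}(p)$ be another Boolean product distribution such that the corresponding natural parameter vectors satisfy $\|z^\star-z\|_2\le B_{\alpha,\lambda}=\mathrm{poly}(1/\lambda)\cdot\sqrt{\log(1/\alpha)}$. Consider an arbitrary truncation set $S\subseteq\Pi_d$ such that $\mathcal{D}(p^\star;S)\ge\alpha$. Assume that the anti-concentration condition holds for the true truncated distribution $\mathcal{D}_S(p^\star)$ with constant $\lambda$. Then, the anti-concentration condition still holds for $\mathcal{D}_S(p)$ with parameter $\mathrm{poly}(\alpha)^{\mathrm{poly}(1/\lambda)}$.
   Context: A Boolean product distribution $\mathcal{D}(p)$ with parameter vector $p\in(0,1)^d$ is the product of $d$ independent Bernoulli distributions with parameters $p_i$; its natural parameter vector $z$ has $z_i=\log\frac{p_i}{1-p_i}$ ($z^\star$ corresponds to $p^\star$ and $z$ to $p$). $\mathcal{D}(p;S)=\sum_{x\in S}\mathcal{D}(p;x)$, and the truncation $\mathcal{D}_S(p)$ assigns probability $\mathcal{D}(p;x)/\mathcal{D}(p;S)$ to $x\in S$ and $0$ otherwise. Anti-concentration condition with parameter $\lambda>0$ for a truncated distribution $\mathcal{P}$: for all unit vectors $w\in\mathbb{R}^d$, $\|w\|_2=1$, and all $c\in\mathbb{R}$, $\Pr_{x\sim\mathcal{P}}[w^Tx\notin(c-\lambda,c+\lambda)]\ge\lambda$. Here $\alpha>0$ is a constant, and $\mathrm{poly}(\cdot)$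 denotes unspecified fixed polynomials (possibly different at each occurrence; those in the conclusion may depend on the one in $B_{\alpha,\lambda}$, but not on $d$). *)

(* Defs.v *)
From mathcomp Require Import all_boot all_order all_algebra.
From mathcomp Require Import reals exp bernoulli_distribution.

Set Implicit Arguments.
Unset Strict Implicit.
Unset Printing Implicit Defensive.

Import Order.TTheory GRing.Theory Num.Theory.

Local Open Scope ring_scope.

(* Distributions on a finite type are represented by their mass functions. *)
Definition prob (R : realType) (T : finType) (D : T -> R) (E : pred T) : R :=
  \sum_(x | E x) D x.

(* It is 0 everywhere if S has mass 0. *)
Definition truncate (R : realType) (T : finType) (D : T -> R) (S : {set T}) :
    T -> R :=
  fun x => if x \in S then D x / prob D (mem S) else 0.

Notation cube d := {ffun 'I_d -> bool}.

Definition cube_vec (R : realType) (d : nat) (x : cube d) : 'rV[R]_d :=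
  \row_i (x i)%:R.

Definition dot (R : realType) (d : nat) (u v : 'rV[R]_d) : R :=
  \sum_i u 0 i * v 0 i.

(* The norm `|v| of the library on 'rV[R]_d is the sup norm. *)
Definition norm2 (R : realType) (d : nat) (v : 'rV[R]_d) : R :=
  Num.sqrt (dot v v).

Definition open_unit_cube (R : realType) (d : nat) (p : 'rV[R]_d) : Prop :=
  forall i, 0 < p 0 i < 1.

Definition bool_product (R : realType) (d : nat) (p : 'rV[R]_d) : cube d -> R :=
  fun x => \prod_i bernoulli_pmf (p 0 i) (x i).

Definition natural_param (R : realType) (d : nat) (p : 'rV[R]_d) : 'rV[R]_d :=
  \row_i ln (p 0 i / (1 - p 0 i)).

Definition anti_concentrated (R : realType) (d : nat) (D : cube d -> R)
    (lambda : R) : Prop :=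
  0 < lambda /\
  forall (w : 'rV[R]_d) (c : R), norm2 w = 1 ->
    lambda <=
      prob D (fun x => dot w (cube_vec R x) \notin `]c - lambda, c + lambda[).

(* Main.v *)
Require Import Defs.
From mathcomp Require Import all_boot all_order all_algebra.
From mathcomp Require Import reals exp.
From mathcomp Require Import ring lra sequences bernoulli_distribution.

Import Order.TTheory GRing.Theory Num.Theory.

Local Open Scope ring_scope.

(** Write D* and D for the two product distributions, and let A be the set of
    x in S with |w.x - c| >= lambda, so that D*(A) >= lambda * alpha.
    By Cauchy-Schwarz, D*(A)^2 <= D(A) * sum_x D*(x)^2 / D(x); the last sum
    factors over the coordinates, and each factor is at most
    (1 + cosh h_i) / 2 <= exp (2 h_i^2) with h = z* - z.  Hence
    D(A) >= (lambda * alpha)^2 exp (- 2 |h|^2), and the bound on |h| turns the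
    exponential into a power of alpha.  Taking Q(a) = a / 2 instead of a keeps
    the base below 1 when alpha = 1, so that a large exponent also absorbs
    lambda^2. *)

Lemma prob_le (R : realType) (T : finType) (D : T -> R) (E F : pred T) :
  (forall x, 0 <= D x) -> (forall x, E x -> F x) -> prob D E <= prob D F.
Proof.
move=> D0 EF; rewrite /prob [leLHS]big_mkcond [leRHS]big_mkcond.
apply: ler_sum => x _; have := EF x.
by case: (E x) => [-> //|_]; case: (F x).
Qed.

Lemma prob_truncate (R : realType) (T : finType) (D : T -> R) (S : {set T})
    (E : pred T) :
  prob (truncate D S) E = prob D [pred x in S | E x] / prob D (mem S).
Proof.
rewrite /prob mulr_suml [LHS]big_mkcond [RHS]big_mkcond.
apply: eq_bigr => x _; rewrite /truncate /prob /=.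
by case: (E x); case: (x \in S).
Qed.

(** The quadratic in [t] given by the sum over [E] of [(D x - t * D' x) ^+ 2 / D' x] is nonnegative;
    its value at the minimiser [prob D E / prob D' E] is the claim. *)
Lemma cauchy_schwarz_prob (R : realType) (T : finType) (D D' : T -> R)
    (E : pred T) : (forall x, 0 < D' x) ->
  prob D E ^+ 2 <= prob D' E * (\sum_(x | E x) D x ^+ 2 / D' x).
Proof.
move=> D'0; set V := \sum_(x | E x) _.
have V0 : 0 <= V.
  by apply: sumr_ge0 => x _; rewrite divr_ge0 ?sqr_ge0 // ltW.
have D'E0 : 0 <= prob D' E by apply: sumr_ge0 => x _; exact: ltW.
have quad t : 0 <= V - 2 * t * prob D E + t ^+ 2 * prob D' E.
  have -> : V - 2 * t * prob D E + t ^+ 2 * prob D' E =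
      \sum_(x | E x) (D x - t * D' x) ^+ 2 / D' x.
    rewrite /V /prob !mulr_sumr -sumrB -big_split /=.
    apply: eq_bigr => x _; have := D'0 x => x0.
    by field; rewrite gt_eqF.
  by apply: sumr_ge0 => x _; rewrite divr_ge0 ?sqr_ge0 // ltW.
(* In the degenerate case [E] is empty, since [D'] is positive at every point. *)
have [D'E|D'E] := eqVneq (prob D' E) 0.
  suff -> : prob D E = 0 by rewrite expr0n /= mulr_ge0.
  rewrite /prob big1 // => x Ex.
  have : D' x <= prob D' E.
    by rewrite /prob (bigD1 x) //= lerDl; apply: sumr_ge0 => y _; exact: ltW.
  by rewrite D'E leNgt D'0.
have D'Ep : 0 < prob D' E by rewrite lt_neqAle eq_sym D'E.
have := quad (prob D E / prob D' E).
have -> : V - 2 * (prob D E / prob D' E) * prob D E +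
   (prob D E / prob D' E) ^+ 2 * prob D' E
   = (prob D' E * V - prob D E ^+ 2) / prob D' E by field.
by rewrite pmulr_lge0 ?invr_gt0 // subr_ge0.
Qed.

(** For [h ^+ 2 <= 1/4], the bound [expR t <= 1 / (1 - t)] at [h] and [- h] gives
    [2 / (1 - h ^+ 2)], which is at most [2 * (1 + 2 * h ^+ 2)]. Otherwise [|h| > 1/2], so both
    exponents are below [2 * h ^+ 2]. *)
Lemma expR_addN_le (R : realType) (h : R) :
  expR h + expR (- h) <= 2 * expR (2 * h ^+ 2).
Proof.
have [hs|hl] := leP (h ^+ 2) (4^-1).
  have half : -1 < h < 1 by apply/andP; split; nra.
  have bnd (t : R) : -1 < t < 1 -> expR t <= (1 - t)^-1.
    move=> /andP[t1 t2]; rewrite -[t in expR t]opprK expRN lef_pV2 ?posrE ?expR_gt0 //.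
      exact: expR_ge1Dx.
    by lra.
  apply: (@le_trans _ _ ((1 - h)^-1 + (1 + h)^-1)).
    rewrite lerD ?bnd //; rewrite -[h in leRHS]opprK bnd //; lra.
  apply: (@le_trans _ _ (2 * (1 + 2 * h ^+ 2))); last first.
    by rewrite ler_pM2l // expR_ge1Dx.
  have h2 : 0 < 1 - h ^+ 2 by lra.
  have -> : (1 - h)^-1 + (1 + h)^-1 = 2 / (1 - h ^+ 2).
    have [hp hm] : 1 + h != 0 /\ 1 - h != 0.
      by split; rewrite gt_eqF //; lra.
    by field; rewrite hp hm gt_eqF.
  rewrite ler_pdivrMr // -subr_ge0.
  have -> : 2 * (1 + 2 * h ^+ 2) * (1 - h ^+ 2) - 2 =
    2 * (h ^+ 2 * (1 - 2 * h ^+ 2)) by ring.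
  by rewrite mulr_ge0 // mulr_ge0 ?sqr_ge0 //; lra.
have bnd (t : R) : 4^-1 < t ^+ 2 -> expR t <= expR (2 * t ^+ 2).
  move=> tl; rewrite ler_expR; have [t0|t0] := leP t 0; first nra.
  have : 2^-1 < t by nra.
  nra.
have := bnd h hl; have := bnd (- h); rewrite sqrrN => /(_ hl); lra.
Qed.

(** The left side is one plus the chi-square divergence of two Bernoulli laws. The exponential of
    the difference of logarithms is their odds ratio, which makes the comparison with cosh an
    inequality of rational functions. *)
Lemma chi2_bernoulli_le (R : realType) (q p : R) :
  0 < q < 1 -> 0 < p < 1 ->
  q ^+ 2 / p + (1 - q) ^+ 2 / (1 - p)
    <= expR (2 * (ln (q / (1 - q)) - ln (p / (1 - p))) ^+ 2).
Proof.
move=> /andP[q0 q1] /andP[p0 p1].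
have q1' : 0 < 1 - q by rewrite subr_gt0.
have p1' : 0 < 1 - p by rewrite subr_gt0.
set h := ln _ - ln _.
have eh : expR h = q / (1 - q) * ((1 - p) / p).
  rewrite expRB !lnK ?posrE ?divr_gt0 //; congr (_ * _).
  by rewrite invf_div.
have ehN : expR (- h) = p / (1 - p) * ((1 - q) / q).
  rewrite expRN eh; field.
  by rewrite !gt_eqF.
have := expR_addN_le R h; rewrite eh ehN => cosh_le.
(* Absorbs the constant term: [(2 + 2 * e) / 4 <= e] when [1 <= e]. *)
have e1 : 1 <= expR (2 * h ^+ 2).
  by rewrite -[leLHS]expR0 ler_expR mulr_ge0 ?sqr_ge0.
(* By 4 q (1 - q) <= 1, the chi-square term (q - p)^2 / (p (1 - p)) is at most
   (q - p)^2 / (4 q (1 - q) p (1 - p)) = (expR h + expR (- h) - 2) / 4. *)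
suff : q ^+ 2 / p + (1 - q) ^+ 2 / (1 - p) <=
    (2 + (q / (1 - q) * ((1 - p) / p) + p / (1 - p) * ((1 - q) / q))) / 4.
  by lra.
rewrite -subr_ge0.
have -> : (2 + (q / (1 - q) * ((1 - p) / p) + p / (1 - p) * ((1 - q) / q))) / 4
   - (q ^+ 2 / p + (1 - q) ^+ 2 / (1 - p)) =
   ((q - p) * (2 * q - 1)) ^+ 2 / (4 * (q * (1 - q) * (p * (1 - p)))).
  by field; rewrite !gt_eqF.
by rewrite divr_ge0 ?sqr_ge0 // !mulr_ge0 // ltW.
Qed.

Section BoolProduct.
Context {R : realType} {d : nat}.
Implicit Types p q : 'rV[R]_d.

Lemma bernoulli_pmf_gt0 (p : R) b : 0 < p < 1 -> 0 < bernoulli_pmf p b.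
Proof.
by case/andP=> p0 p1; rewrite /bernoulli_pmf; case: b => //; rewrite subr_gt0.
Qed.

Lemma bool_product_gt0 p x : open_unit_cube p -> 0 < bool_product p x.
Proof. by move=> p01; apply: prodr_gt0 => i _; exact: bernoulli_pmf_gt0. Qed.

Lemma prob_bool_product_le1 p (E : pred (cube d)) :
  open_unit_cube p -> prob (bool_product p) E <= 1.
Proof.
move=> p01; apply: (@le_trans _ _ (prob (bool_product p) predT)).
  by apply: prob_le => // x; exact/ltW/bool_product_gt0.
rewrite /prob /bool_product -(bigA_distr_bigA (fun i => bernoulli_pmf (p 0 i))).
rewrite big1 // => i _.
by rewrite big_bool /= subrKC.
Qed.

Lemma chi2_bool_product_le q p : open_unit_cube q -> open_unit_cube p ->
  \sum_x bool_product q x ^+ 2 / bool_product p x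
    <= expR (2 * norm2 (natural_param q - natural_param p) ^+ 2).
Proof.
move=> q01 p01.
rewrite sqr_sqrtr; last by apply: sumr_ge0 => i _; rewrite -expr2 sqr_ge0.
rewrite /dot mulr_sumr expR_sum.
have -> : \sum_x bool_product q x ^+ 2 / bool_product p x =
   \sum_(x : cube d) \prod_i
      (bernoulli_pmf (q 0 i) (x i) ^+ 2 / bernoulli_pmf (p 0 i) (x i)).
  by apply: eq_bigr => x _; rewrite /bool_product -prodrXl -prodf_div.
rewrite -(bigA_distr_bigA (fun i b =>
  bernoulli_pmf (q 0 i) b ^+ 2 / bernoulli_pmf (p 0 i) b)).
apply: ler_prod => i _; rewrite big_bool /= !mxE -expr2 chi2_bernoulli_le //.
case/andP: (q01 i) => q0 q1; case/andP: (p01 i) => p0 p1.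
by rewrite addr_ge0 // divr_ge0 ?sqr_ge0 // ltW // subr_gt0.
Qed.

Lemma prob_bool_product_ge q p (E : pred (cube d)) :
  open_unit_cube q -> open_unit_cube p ->
  prob (bool_product q) E ^+ 2
    * expR (- (2 * norm2 (natural_param q - natural_param p) ^+ 2))
    <= prob (bool_product p) E.
Proof.
move=> q01 p01; rewrite expRN ler_pdivrMr ?expR_gt0 //.
have pgt0 x := bool_product_gt0 p x p01.
apply: le_trans (cauchy_schwarz_prob _ _ (bool_product q) _ E pgt0) _.
apply: ler_wpM2l; first by apply: sumr_ge0 => x _; exact: ltW.
apply: le_trans (chi2_bool_product_le q p q01 p01).
rewrite [leLHS]big_mkcond; apply: ler_sum => x _; case: ifP => // _.
by rewrite divr_ge0 ?sqr_ge0 // ltW.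
Qed.

End BoolProduct.

(** After taking logarithms, with [L = - ln alpha >= 0], the claim is [(2 + 2 * b ^+ 2 + 4 / lambda)
    * (L + ln 2) >= 2 * L + 2 * b ^+ 2 * L - 2 * ln lambda]. The last term is covered by
    [4 / lambda * ln 2], since [ln 2 >= 1/2] and [- ln lambda <= 1 / lambda]. *)
Lemma powR_half_le (R : realType) (alpha lambda b : R) :
  0 < alpha <= 1 -> 0 < lambda ->
  (alpha / 2) `^ (2 + 2 * b ^+ 2 + 4 * lambda^-1)
    <= (lambda * alpha) ^+ 2 * expR (- (2 * (b ^+ 2 * ln alpha^-1))).
Proof.
move=> /andP[a0 a1] l0.
rewrite /powR gt_eqF ?divr_gt0 //.
have -> : (lambda * alpha) ^+ 2 = expR (2 * (ln lambda + ln alpha)).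
  by rewrite -lnM ?posrE // mulrDl mul1r expRD lnK ?posrE ?mulr_gt0.
rewrite -expRD ler_expR lnM ?posrE // ?invr_gt0 // !lnV ?posrE //.
have lna : ln alpha <= 0 by exact: ln_le0.
have ln2 : 2^-1 <= ln 2 :> R.
  have := @le_ln1Dx R (- 2^-1).
  have -> : 1 + - 2^-1 = 2^-1 :> R by field.
  rewrite lnV ?posrE //; lra.
have lnl : - ln lambda <= lambda^-1.
  have := @le_ln1Dx R (lambda^-1 - 1).
  rewrite subrKC lnV ?posrE // => H.
  have : 0 < lambda^-1 by rewrite invr_gt0.
  by move=> ?; have := H; lra.
have : 0 < lambda^-1 by rewrite invr_gt0.
have := sqr_ge0 b.
move: (b ^+ 2) lambda^-1 lnl => B x lnl B0 x0.
nra.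
Qed.

Theorem lemma12 (R : realType) (P : {poly R}) :
  exists Q T : {poly R},
    (forall a : R, 0 < a -> 0 < Q.[a]) /\
    (forall x : R, 0 < x -> 0 < T.[x]) /\
    forall (d : nat) (pstar p : 'rV[R]_d) (S : {set cube d})
           (alpha lambda : R),
      open_unit_cube pstar ->
      open_unit_cube p ->
      0 < alpha ->
      0 < lambda ->
      norm2 (natural_param pstar - natural_param p)
        <= P.[lambda^-1] * Num.sqrt (ln alpha^-1) ->
      alpha <= prob (bool_product pstar) (mem S) ->
      anti_concentrated (truncate (bool_product pstar) S) lambda ->
      anti_concentrated (truncate (bool_product p) S)
        (Q.[alpha] `^ T.[lambda^-1]).
Proof.
(* The three terms pay, in order, for [alpha ^+ 2], the chi-square factor and [lambda ^+ 2]. *)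
pose T : {poly R} := 2%:P + 2 *: P ^+ 2 + 4 *: 'X.
have TE x : T.[x] = 2 + 2 * P.[x] ^+ 2 + 4 * x.
  by rewrite !hornerD hornerC !hornerZ hornerX horner_exp.
exists (2^-1 *: 'X), T.
split; first by move=> a a0; rewrite hornerZ hornerX mulr_gt0 ?invr_gt0.
split.
  move=> x x0; rewrite TE; have := sqr_ge0 P.[x]; lra.
move=> d q p S alpha lambda q01 p01 a0 l0 dist_le aS [_ acq].
have a1 : alpha <= 1 by apply: le_trans aS _; exact: prob_bool_product_le1.
rewrite hornerZ hornerX [2^-1 * _]mulrC TE.
set l' := _ `^ _.
split; first by rewrite powR_gt0 // divr_gt0.
move=> w c w1; set E := fun x => _.
have D0 (r : 'rV[R]_d) x : open_unit_cube r -> 0 <= bool_product r x.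
  by move=> ?; exact/ltW/bool_product_gt0.
set El : pred (cube d) :=
  fun x => dot w (cube_vec R x) \notin `]c - lambda, c + lambda[.
have qS0 : 0 < prob (bool_product q) (mem S) by exact: lt_le_trans aS.
have := acq w c w1; rewrite -/El prob_truncate ler_pdivlMr // => lqS.
have l1 : lambda <= 1.
  rewrite -(@ler_pM2r _ (prob (bool_product q) (mem S))) // mul1r.
  apply: le_trans lqS _; apply: prob_le => [x|x /andP[]//]; exact: D0.
have laq : lambda * alpha <= prob (bool_product q) [pred x in S | El x].
  by apply: le_trans lqS; rewrite ler_pM2l.
have la0 : 0 <= lambda * alpha by rewrite mulr_ge0 // ltW.
have norm_le : norm2 (natural_param q - natural_param p) ^+ 2 <=
    P.[lambda^-1] ^+ 2 * ln alpha^-1.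
  have lna : 0 <= ln alpha^-1 by rewrite ln_ge0 // invf_ge1.
  rewrite -[X in _ * X]sqr_sqrtr // -exprMn ler_pXn2r // nnegrE ?sqrtr_ge0 //.
  (* [P] may take negative values; the bound is nonnegative because it dominates a norm. *)
  by apply: le_trans dist_le; exact: sqrtr_ge0.
have l'le := powR_half_le _ alpha lambda P.[lambda^-1]
  (introT andP (conj a0 a1)) l0.
have l'p : l' <= prob (bool_product p) [pred x in S | El x].
  apply: le_trans l'le _.
  apply: le_trans (prob_bool_product_ge q p _ q01 p01).
  apply: ler_pM; rewrite ?sqr_ge0 ?expR_ge0 //.
    by rewrite ler_pXn2r // nnegrE // (le_trans la0).
  by rewrite ler_expR lerN2 ler_pM2l.
(* The parameter is also the radius of the excluded interval: shrinking it from [lambda] to [l']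
   gives that [El] implies [E]. *)
have l'l : l' <= lambda.
  apply: le_trans l'le _.
  apply: (@le_trans _ _ ((lambda * alpha) ^+ 2)).
    rewrite ler_piMr ?sqr_ge0 // -[leRHS]expR0 ler_expR oppr_le0 mulr_ge0 //.
    by rewrite (le_trans _ norm_le) // sqr_ge0.
  have la1 : lambda * alpha <= lambda.
    by rewrite ler_piMr // ltW.
  by apply: le_trans la1; rewrite expr2 ler_piMr //
    (le_trans _ l1) // ler_piMr // ltW.
have l'0 : 0 < l' by rewrite powR_gt0 // divr_gt0.
have El_E x : El x -> E x.
  rewrite /El /E !in_itv /=; apply: contra => /andP[c1 c2].
  by apply/andP; split; lra.
have l'E : l' <= prob (bool_product p) [pred x in S | E x].
  apply: le_trans l'p _; apply: prob_le => [x|x /andP[xS Ex]].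
    exact: D0.
  by rewrite inE /= xS; exact: El_E.
have pS0 : 0 < prob (bool_product p) (mem S).
  apply: lt_le_trans l'0 (le_trans l'E _).
  by apply: prob_le => [x|x /andP[]//]; exact: D0.
(* Normalising by the mass of [S], which is at most 1, can only increase the probability. *)
rewrite prob_truncate ler_pdivlMr //; apply: le_trans l'E.
by rewrite ler_piMr ?prob_bool_product_le1 // ltW.
Qed.
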